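(* Let $p\ge5$ be a prime and let $E\in\mathbb{F}_p$, $E\neq0$. The Vieta graph of the quartic $x^2+y^2+z^2+t^2=2Exyzt$ over $\mathbb{F}_p$ satisfies the following. (a) If $p\equiv3\pmod 4$: there are $p^3+5p-1$ vertices in total; there are $4(p^2-4p+3)$ vertices of degree $3$, $0$ of degree $2$, $0$ of degree $1$, and $1$ of degree $0$. (b) If $p\equiv1\pmod 4$: there are $p^3-7p-1+8\sigma(E)A_2(p)\cdot p$ vertices in total; there are $4\big(p^2-14p+45+4\sigma(2E)(A_2(p)^2-2p+9)\big)$ vertices of degree $3$, $6\big(6p-22+4\sigma(2E)(p-5)\big)$ of degree $2$, $32\big(1+\sigma(2E)\big)$ of degree $1$, and $1$ of degree $0$.
   Context: $\sigma:\mathbb{F}_p\to\{-1,0,1\}\subset\mathbb{Z}$ denotes the quadratic character: $\sigma(a)=1$ if $a$ is a nonzero square, $\sigma(a)=-1$ if $a$ is a non-square, $\sigma(0)=0$. For a prime $p\equiv1\pmod 4$, $A_2(p)$ is the integer $A$ determined by writing $p=A^2+B^2$ with $A,B\in\mathbb{Z}$ and $A\equiv-1\pmod 4$. The Vieta graph of $x^2+y^2+z^2+t^2=2Exyzt$ is the finite simple graph whose vertices are the solutions $(x,y,z,t)\in\mathbb{F}_p^4$, where two distinct vertices are joined by an edge whenever one is a Vieta flip of the other. The Vieta flips of $(x,y,z,t)$ are $(2Eyzt-x,y,z,t)$, $(x,2Exzt-y,z,t)$, $(x,y,2Exyt-z,t)$, $(x,y,z,2Exyz-t)$. *)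

(* Defs.v *)
From mathcomp Require Import all_boot all_order all_algebra.
From mathcomp Require classical_sets.

Set Implicit Arguments.
Unset Strict Implicit.
Unset Printing Implicit Defensive.

Import GRing.Theory Num.Theory.
Local Open Scope ring_scope.

Definition sigma (F : finFieldType) (a : F) : int :=
  if a == 0 then 0 else if [exists b : F, a == b ^+ 2] then 1 else -1.

Definition is_A2 (p : nat) (A : int) : Prop :=
  (exists B : int, p%:Z = A ^+ 2 + B ^+ 2) /\ (A = -1 %[mod 4])%Z.

(* The A such that [is_A2 p A]. For a prime p = 1 mod 4 it exists and is unique
   (Fermat's two-square theorem; the congruence picks the odd square and its
   sign); if there is no such A, the value is the arbitrary default 0. *)
Definition A2 (p : nat) : int := classical_sets.xget 0 (is_A2 p).

Section VietaGraph.
Variables (F : finFieldType) (E : F).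

Definition point : finType := (F * F * F * F)%type.

Definition vieta_vertices : {set point} :=
  [set v : point | let: (x, y, z, t) := v in
     x ^+ 2 + y ^+ 2 + z ^+ 2 + t ^+ 2 == 2%:R * E * x * y * z * t].

Definition vieta_flips (v : point) : seq point :=
  let: (x, y, z, t) := v in
  [:: (2%:R * E * y * z * t - x, y, z, t);
      (x, 2%:R * E * x * z * t - y, z, t);
      (x, y, 2%:R * E * x * y * t - z, t);
      (x, y, z, 2%:R * E * x * y * z - t)].

Definition vieta_adj : rel point :=
  fun v w => (v != w) && ((w \in vieta_flips v) || (v \in vieta_flips w)).

Definition vieta_degree (v : point) : nat :=
  #|[set w in vieta_vertices | vieta_adj v w]|.

(* Valued in [int] because the formulas for this number involve subtraction. *)
Definition num_of_degree (d : nat) : int :=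
  #|[set v in vieta_vertices | vieta_degree v == d]|%:Z.

End VietaGraph.

(* Main.v *)
Require Import Defs.
From mathcomp Require Import all_boot all_order all_algebra.
From mathcomp Require Import fingroup cyclic finfield.
From mathcomp Require Import zify ring.

Set Implicit Arguments.
Unset Strict Implicit.
Unset Printing Implicit Defensive.

Import GRing.Theory Num.Theory.
Local Open Scope ring_scope.

(** A vertex has degree 4 minus the number of its flips that fix it, and the
    last flip fixes [(x, y, z, t)] iff [t = E x y z]. So the degrees are
    determined by the binomial moments of the number of fixing flips, which by
    symmetry are the sums [sum4 (fixedk E)] over points fixed by [k] given
    flips. Solving a quadratic in one coordinate turns each of them into
    character sums, which reduce to the Jacobsthal sums
    [jac c = \sum_w sigma w * sigma (w ^ 2 + c)]. For [q = 1 mod 4] the second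
    moment of [jac] gives [jac 1 ^ 2 + jac g ^ 2 = 4 q] for a nonresidue [g];
    the value of [jac 1] mod 8 and the uniqueness of the representation as a
    sum of two squares then identify [jac 1] with [2 * A2 q]. *)

(** * The quadratic character of a finite field of odd order and its complete sums *)

Section QuadraticCharacter.
Variable F : finFieldType.
Hypothesis odd_card : odd #|F|.
Implicit Types (a b c x : F).

Local Notation q := (#|F|).
Local Notation sg := (@sigma F).

Lemma card_gt1 : (1 < q)%N.
Proof. exact: finNzRing_gt1. Qed.

(** By Lagrange in the additive group, [q] copies of [1] add up to [0]; with [q] odd, [2 = 0] would
    then give [1 = 0]. *)
Lemma odd_card_two_neq0 : 2%:R != 0 :> F.
Proof.
apply/eqP => two0.
have: (q%:R : F) = 0.
  have := @expg_cardG F [set: F] (1%R : F) (in_setT _).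
  by rewrite FinRing.zmodXgE cardsT.
rewrite -(odd_double_half q) odd_card natrD -mul2n natrM two0 mul0r addr0.
by move/eqP; rewrite oner_eq0.
Qed.

Let two_neq0 := odd_card_two_neq0.

Lemma neg1_neq1 : (-1 : F) != 1.
Proof.
by rewrite -subr_eq0 -opprD oppr_eq0.
Qed.

Lemma sigma_val a : [\/ sg a = 0, sg a = 1 | sg a = -1].
Proof.
rewrite /sigma; case: ifP => _; first by constructor 1.
by case: ifP => _; [constructor 2|constructor 3].
Qed.

Lemma sigma0 : sg 0 = 0.
Proof. by rewrite /sigma eqxx. Qed.

Lemma sigma_eq0 a : (sg a == 0) = (a == 0).
Proof. by rewrite /sigma; case: (a == 0) => //; case: ifP. Qed.

Lemma sigma_sqr a : sg (a ^+ 2) = (a != 0)%:R.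
Proof.
rewrite /sigma expf_eq0 /=; case: eqP => //= _.
by case: existsP => // -[]; exists a.
Qed.

(** Euler's criterion, read off from a generator [g] of the multiplicative group: the nonzero
    squares are its even powers, and [g ^+ h = -1]. *)
Lemma sigma_euler a : (sg a)%:~R = a ^+ (q.-1)./2 :> F.
Proof.
have q_gt2 : (2 < q)%N.
  by have := card_gt1; move: odd_card; lia.
set h := (q.-1)./2.
have nE : q.-1 = h.*2.
  by move: odd_card; rewrite /h; lia.
have h_gt0 : (0 < h)%N by rewrite /h; lia.
have unit x : x != 0 -> x ^+ q.-1 = 1.
  move=> x0; apply: (mulfI x0); rewrite -exprS prednK ?expf_card ?mulr1 //.
  by apply: ltn_trans q_gt2.
have /hasP[g _ g_prim] : has (q.-1).-primitive_root (enum [set~ (0:F)]).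
  apply: has_prim_root; first by rewrite nE double_gt0.
  - by apply/allP => x; rewrite mem_enum !inE unity_rootE => /unit ->.
  - exact: enum_uniq.
  - by rewrite -cardE cardsC1.
(* [g ^+ h] is a square root of [1], and it is not [1] because [h] is less than the order [2h] of
   [g]. *)
have gh : g ^+ h = -1.
  have: (g ^+ h) ^+ 2 == 1 by rewrite -exprM muln2 -nE (prim_expr_order g_prim).
  rewrite sqrf_eq1 -(prim_order_dvd g_prim) nE => /orP[|/eqP //].
  by move/(dvdn_leq h_gt0); lia.
rewrite /sigma; case: eqP => [->|/eqP a0]; first by rewrite expr0n; case: (h) h_gt0.
case: existsP => [[b /eqP ab]|nsq].
  rewrite ab -exprM mul2n -nE unit //; apply: contraNneq a0 => b0.
  by rewrite ab b0 expr0n.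
have [i ai] := prim_rootP g_prim (unit a a0).
rewrite ai exprAC gh -signr_odd; case odd_i: (odd i); first by [].
case: nsq; exists (g ^+ i./2).
by rewrite ai -exprM muln2 -[X in _ ^+ X](odd_double_half i) odd_i.
Qed.

(** Euler's criterion makes both sides agree in [F]; they agree in [int] because [-1], [0], [1] stay
    distinct in [F]. *)
Lemma sigmaM : {morph sg : a b / a * b}.
Proof.
move=> a b; have: (sg (a * b))%:~R = (sg a * sg b)%:~R :> F.
  by rewrite intrM !sigma_euler exprMn.
have N1 := neg1_neq1; have N0 := oner_neq0 F.
have N2 : -1 != 0 :> F by rewrite oppr_eq0.
case: (sigma_val (a * b)) => ->; case: (sigma_val a) => ->;
  case: (sigma_val b) => -> //= /eqP.
all: rewrite ?mulr0 ?mul0r ?mulr1 ?mul1r ?mulrNN ?mulr1 ?rmorphN ?rmorph0 ?rmorph1 /=.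
all: rewrite ?(negPf N0) ?(negPf N1) ?(negPf N2) ?[0 == _]eq_sym ?[1 == -1]eq_sym.
all: by rewrite ?(negPf N0) ?(negPf N1) ?(negPf N2).
Qed.

Lemma sigma1 : sg 1 = 1.
Proof. by rewrite -[1](expr1n _ 2) sigma_sqr oner_eq0. Qed.

Lemma sigma_norm a : a != 0 -> sg a ^+ 2 = 1.
Proof. by move=> a0; rewrite expr2 -sigmaM -expr2 sigma_sqr a0. Qed.

Lemma sigmaV a : sg a^-1 = sg a.
Proof.
have [->|a0] := eqVneq a 0; first by rewrite invr0.
by rewrite -[RHS]mulr1 -sigma1 -(mulfV a0) sigmaM mulrA -expr2 sigma_norm ?mul1r.
Qed.

(** If every element were a square, squaring would be a surjection of a finite set onto itself,
    hence injective, against [(-1) ^ 2 = 1 ^ 2]. *)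
Lemma exists_nonresidue : exists g, sg g = -1.
Proof.
have [/existsP[g /eqP]|/existsPn no] := boolP [exists g, sg g == -1].
  by exists g.
have sqr a : exists b, a == b ^+ 2.
  apply/existsP; move: (no a); rewrite /sigma.
  have [->|_] := eqVneq a 0; first by move=> _; apply/existsP; exists 0; rewrite expr0n.
  by case: ifP.
pose r a := xchoose (sqr a).
have rK : cancel r (fun x => x ^+ 2) by move=> a; rewrite -(eqP (xchooseP (sqr a))).
have [r' _ r'K] := injF_bij (can_inj rK).
have sqr_inj : injective (fun x : F => x ^+ 2).
  by move=> x y; rewrite -[x]r'K -[y]r'K !rK => ->.
by have /eqP := sqr_inj (-1) 1 (sqrrN 1); rewrite (negPf neg1_neq1).
Qed.

(** The bridge from counting solutions to character sums. *)
Lemma count_sqrt u : (\sum_(x : F) (x ^+ 2 == u)%:R) = 1 + sg u :> int.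
Proof.
rewrite /sigma; have [->|u0] := eqVneq u 0.
  rewrite (bigD1 0) //= expr0n eqxx big1 // => x x0.
  by rewrite expf_eq0 (negPf x0).
case: existsP => [[b /eqP ub]|nsq]; last first.
  by rewrite big1 // => x _; case: eqP => // xu; case: nsq; exists x; rewrite xu.
have b0 : b != 0 by apply: contraNneq u0 => b0; rewrite ub b0 expr0n.
have bN : - b != b by rewrite -subr_eq0 -opprD oppr_eq0 -mulr2n -mulr_natr mulf_neq0.
rewrite (bigD1 b) // (bigD1 (- b)) //= ub sqrrN eqxx big1 // => x /andP[xb xNb].
by rewrite eqf_sqr (negPf xb) (negPf xNb).
Qed.

Lemma sum_sqr (f : F -> int) :
  \sum_(x : F) f (x ^+ 2) = \sum_(u : F) (1 + sg u) * f u.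
Proof.
rewrite (partition_big (fun x => x ^+ 2) xpredT) //=; apply: eq_bigr => u _.
rewrite -count_sqrt mulr_suml big_mkcond; apply: eq_bigr => x _.
by case: eqP => [->|]; rewrite ?mul1r ?mul0r.
Qed.

Lemma sum_sigma : \sum_(a : F) sg a = 0.
Proof.
have [g g_nr] := exists_nonresidue.
have g0 : g != 0 by rewrite -sigma_eq0 g_nr.
have: \sum_(a : F) sg a = - \sum_(a : F) sg a; last by lia.
rewrite [LHS](reindex_inj (mulfI g0)) -sumrN; apply: eq_bigr => a _.
by rewrite sigmaM g_nr mulN1r.
Qed.

Lemma sum_sigma_nz : \sum_(a : F | a != 0) sg a = 0.
Proof. by rewrite -[RHS]sum_sigma [RHS](bigD1 0) //= sigma0 add0r. Qed.

Lemma sum_one : \sum_(a : F) (1 : int) = q%:Z.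
Proof. by rewrite sumr_const natz. Qed.

Lemma sum_one_nz : \sum_(a : F | a != 0) (1 : int) = q%:Z - 1.
Proof. by rewrite -sum_one [in RHS](bigD1 (0 : F)) //= [RHS]addrC addKr. Qed.

(** For [u != 0] the summand is [sg (1 + c / u)]. If [c != 0], its argument runs over all elements
    except [1], so the sum is [- sg 1]. *)
Lemma sum_sigma_shift c :
  \sum_(u : F) sg u * sg (u + c) = q%:Z * (c == 0)%:R - 1.
Proof.
rewrite (bigD1 0) //= sigma0 mul0r add0r.
have [->|c0] := eqVneq c 0.
  rewrite mulr1 -sum_one_nz; apply: eq_bigr => u u0.
  by rewrite addr0 -expr2 sigma_norm.
transitivity (\sum_(u : F | u != 0) sg (1 + c / u)).
  apply: eq_bigr => u u0; rewrite -[RHS]mul1r -(sigma_norm u0) expr2 -mulrA.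
  by congr (_ * _); rewrite -sigmaM; congr (sg _); field.
rewrite mulr0 add0r (reindex_inj (@invr_inj F)) /=.
transitivity (\sum_(u : F) sg (1 + c * u) - 1).
  rewrite [in RHS](bigD1 0) //= mulr0 addr0 sigma1 [RHS]addrC addKr.
  by apply: eq_big => u; rewrite ?invr_eq0 // invrK.
have inj : injective (fun u => 1 + c * u) by move=> x y /addrI /(mulfI c0).
by have := reindex_inj inj (P := xpredT) (F := sg) => /= <-; rewrite sum_sigma sub0r.
Qed.

Lemma sum_sigma_sqr_shift c : \sum_(x : F) sg (x ^+ 2 + c) = q%:Z * (c == 0)%:R - 1.
Proof.
rewrite (sum_sqr (fun u => sg (u + c))) -sum_sigma_shift.
under eq_bigr do rewrite mulrDl mul1r.
rewrite big_split /= -[RHS]add0r; congr (_ + _).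
have := reindex_inj (@addIr F c) (P := xpredT) (F := sg) => /= <-.
exact: sum_sigma.
Qed.

(** The terms with factor [q] arise only when a coefficient vanishes. In [sum_vieta] these
    degenerate terms are supported on the curves [hyperbola] and [isotropic]. *)
Lemma sum_sigma_quad a c :
  \sum_(x : F) sg (a * x ^+ 2 + c) =
  q%:Z * ((a == 0)%:R * sg c + (c == 0)%:R * sg a) - sg a.
Proof.
have [->|a0] := eqVneq a 0.
  rewrite sigma0 subr0 mulr0 addr0 mul1r -sum_one mulr_suml.
  by apply: eq_bigr => x _; rewrite mul0r add0r mul1r.
transitivity (sg a * \sum_(x : F) sg (x ^+ 2 + c / a)).
  rewrite mulr_sumr; apply: eq_bigr => x _; rewrite -sigmaM.
  by congr (sg _); field.
rewrite sum_sigma_sqr_shift mulf_eq0 invr_eq0 (negPf a0) orbF /=; ring.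
Qed.

(** * Jacobsthal sums and their second moment *)

Definition jac c : int := \sum_(w : F) sg w * sg (w ^+ 2 + c).

(** Summing over [u = x ^ 2] with weight [1 + sg u] leaves a quadratic sum from the [1] and, after
    the scaling [w = a u], a Jacobsthal sum from the [sg u]. *)
Lemma sum_sigma_quartic a c : a != 0 ->
  \sum_(x : F) sg (a ^+ 2 * x ^+ 4 + c) = q%:Z * (c == 0)%:R - 1 + sg a * jac c.
Proof.
move=> a0.
under eq_bigr do rewrite (exprM _ 2 2).
rewrite (sum_sqr (fun u => sg (a ^+ 2 * u ^+ 2 + c))).
under eq_bigr do rewrite mulrDl mul1r.
rewrite big_split /= sum_sigma_quad expf_eq0 (negPf a0) /= sigma_sqr a0.
congr (_ + _); first by rewrite mul0r add0r mulr1.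
rewrite /jac mulr_sumr [RHS](reindex_inj (mulfI a0)); apply: eq_bigr => w _.
by rewrite sigmaM mulrA mulrA -expr2 sigma_norm // mul1r exprMn.
Qed.

Lemma jac0 : jac 0 = 0.
Proof.
rewrite /jac -[RHS]sum_sigma; apply: eq_bigr => w _.
rewrite addr0 sigma_sqr; have [->|w0] := eqVneq w 0; first by rewrite sigma0.
by rewrite mulr1.
Qed.

(** Scale [w] by [a]. The case [a = -1] gives [jac_odd], and [a = i] relates [jac (-1)] to
    [jac 1]. *)
Lemma jacM a c : jac (a ^+ 2 * c) = sg a * jac c.
Proof.
have [->|a0] := eqVneq a 0; first by rewrite expr0n mul0r jac0 sigma0 mul0r.
rewrite /jac (reindex_inj (mulfI a0)) mulr_sumr; apply: eq_bigr => w _.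
rewrite exprMn sigmaM -mulrDr [sg (a^+2 * _)]sigmaM sigma_sqr a0 mul1r; ring.
Qed.

Lemma jac_odd c : sg (-1) = -1 -> jac c = 0.
Proof.
move=> eps; have := jacM (-1) c; rewrite sqrrN expr1n mul1r eps; lia.
Qed.

Lemma sigma_sign_val a (k : nat) : a ^+ (q.-1)./2 = (-1) ^+ k -> sg a = (-1) ^+ k.
Proof.
move=> ak; have := sigma_euler a; rewrite ak -(signr_odd F) -(signr_odd int).
have N1 := neg1_neq1; have N0 := oner_neq0 F.
have N2 : -1 != 0 :> F by rewrite oppr_eq0.
case: (sigma_val a) => ->; case: (odd k) => //= /eqP.
all: rewrite ?expr0 ?expr1 ?rmorphN ?rmorph0 ?rmorph1 /=.
all: rewrite ?(negPf N0) ?(negPf N1) ?(negPf N2) ?[0 == _]eq_sym ?[1 == -1]eq_sym.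
all: by rewrite ?(negPf N0) ?(negPf N1) ?(negPf N2).
Qed.

Lemma sigmaN1 : sg (-1) = (-1) ^+ (q.-1)./2.
Proof. exact: sigma_sign_val. Qed.

Lemma sigma_eq1 a : sg a = 1 -> exists2 b, b != 0 & a = b ^+ 2.
Proof.
move=> a1; have a0 : a != 0 by rewrite -sigma_eq0 a1.
move: a1; rewrite /sigma (negPf a0); case: existsP => // -[b /eqP ab] _.
by exists b => //; apply: contraNneq a0 => b0; rewrite ab b0 expr0n.
Qed.

Lemma sum_sigma_fiber w : sg (-1) = 1 ->
  \sum_(v : F) (v ^+ 2 == w ^+ 2)%:R * sg v = 2 * sg w.
Proof.
move=> eps; have [->|w0] := eqVneq w 0.
  rewrite sigma0 mulr0 big1 // => v _; rewrite expr0n expf_eq0 /=.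
  by have [->|] := eqVneq v 0; rewrite ?sigma0 ?mul0r.
have wN : - w != w by rewrite -subr_eq0 -opprD oppr_eq0 -mulr2n -mulr_natr mulf_neq0.
rewrite (bigD1 w) // (bigD1 (- w)) //= sqrrN eqxx big1 => [|x /andP[xw xNw]].
  rewrite -(mulN1r w) sigmaM eps /=; ring.
by rewrite eqf_sqr (negPf xw) (negPf xNw) mul0r.
Qed.

(** Expand the square and sum over [m] first: each pair [(w, v)] gets [q] if [v ^ 2 = w ^ 2], minus
    [1]. The [-1] terms cancel because [sg] sums to [0], and each nonzero [w] keeps the two values
    [v = w] and [v = - w]. *)
Lemma sum_jac_sqr : sg (-1) = 1 ->
  \sum_(m : F) jac m ^+ 2 = 2 * q%:Z * (q%:Z - 1).
Proof.
move=> eps.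
have jac2E m : jac m ^+ 2 = \sum_(w : F) \sum_(v : F)
    sg w * sg v * (sg (w ^+ 2 + m) * sg (v ^+ 2 + m)).
  rewrite expr2 /jac mulr_suml; apply: eq_bigr => w _.
  by rewrite mulr_sumr; apply: eq_bigr => v _; ring.
under eq_bigr do rewrite jac2E.
rewrite exchange_big /=; under eq_bigr do rewrite exchange_big /=.
have inner w v : \sum_(m : F) sg w * sg v * (sg (w ^+ 2 + m) * sg (v ^+ 2 + m)) =
    q%:Z * sg w * ((v ^+ 2 == w ^+ 2)%:R * sg v) - sg w * sg v.
  rewrite -mulr_sumr (reindex_inj (@addIr F (- w ^+ 2))) /=.
  under eq_bigr => m _.
    rewrite [w ^+ 2 + _](_ : _ = m); last by ring.
    rewrite [v ^+ 2 + _](_ : _ = m + (v ^+ 2 - w ^+ 2)); last by ring.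
    over.
  by rewrite sum_sigma_shift subr_eq0; ring.
under eq_bigr => w _.
  under eq_bigr do rewrite inner.
  rewrite big_split /= -mulr_sumr sum_sigma_fiber // sumrN -mulr_sumr sum_sigma mulr0 oppr0 addr0.
  over.
rewrite (bigD1 (0 : F)) //= sigma0 !mulr0 add0r -sum_one_nz mulr_sumr.
by apply: eq_bigr => w w0; rewrite -(sigma_norm w0); ring.
Qed.

(** By [jacM], [jac m ^ 2] takes only the values [jac 1 ^ 2] and [jac g ^ 2] for [m != 0], each
    equally often, so the second moment determines their sum. *)
Lemma jac_two_squares g : sg (-1) = 1 -> sg g = -1 ->
  jac 1 ^+ 2 + jac g ^+ 2 = 4 * q%:Z.
Proof.
move=> eps g_nr; have g0 : g != 0 by rewrite -sigma_eq0 g_nr.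
(* A function constant on nonzero squares and on nonsquares is affine in [sg m]; doubling avoids
   division in [int]. *)
have jacE m : m != 0 ->
    2 * jac m ^+ 2 = (jac 1 ^+ 2 + jac g ^+ 2) * 1 + (jac 1 ^+ 2 - jac g ^+ 2) * sg m.
  move=> m0; have sgm0 : sg m != 0 by rewrite sigma_eq0.
  case: (sigma_val m) => sgm; first by rewrite sgm eqxx in sgm0.
    have [b b0 ->] := sigma_eq1 sgm.
    rewrite -[in LHS](mulr1 (b ^+ 2)) jacM exprMn sigma_norm // sigma_sqr b0 /=; ring.
  have [|b b0 mgE] := @sigma_eq1 (m / g); first by rewrite sigmaM sigmaV sgm g_nr.
  have -> : m = b ^+ 2 * g by rewrite -mgE divfK.
  rewrite jacM exprMn sigma_norm // sigmaM g_nr sigma_sqr b0 /=; ring.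
have := sum_jac_sqr eps; rewrite (bigD1 (0 : F)) //= jac0 expr0n add0r => /(congr1 ( *%R 2)).
rewrite mulr_sumr (eq_bigr _ jacE) big_split /= -!mulr_sumr sum_sigma_nz sum_one_nz mulr0 addr0.
have q_gt1 : q%:Z - 1 != 0 by have := card_gt1; lia.
move=> eqn; apply: (mulIf q_gt1); rewrite eqn; ring.
Qed.

(** * The value of [jac 1] modulo 8 when [-1] is a square *)

Section FourthRootOfUnity.
Variable i : F.
Hypothesis i_sqr : i ^+ 2 = -1.

Lemma imag_neq0 : i != 0.
Proof.
by apply: contraNneq (oner_neq0 F) => i0; rewrite -oppr_eq0 -i_sqr i0 expr0n.
Qed.

(** This is the identity [(1 + i) ^ 2 = 2 i]. *)
Lemma sigma_imag : sg i = sg 2%:R.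
Proof.
have i1 : 1 + i != 0.
  apply: contraNneq neg1_neq1 => i1; rewrite -i_sqr.
  by rewrite -[i](addrK 1) [i + 1]addrC i1 sub0r sqrrN expr1n.
have -> : 2%:R = (1 + i) ^+ 2 * i^-1.
  have -> : (1 + i) ^+ 2 = 1 + 2%:R * i + i ^+ 2 by ring.
  by rewrite i_sqr; field; exact: imag_neq0.
by rewrite sigmaM sigma_sqr i1 mul1r sigmaV.
Qed.

(** Zero and the fourth roots of unity are set apart because [w], [- w], [1 / w], [- 1 / w] are four
    distinct elements exactly for the other [w]. *)
Lemma sum_split_mu4 (f : F -> int) :
  \sum_(w : F) f w = f 0 + f 1 + f (-1) + f i + f (- i) +
    \sum_(w : F | w \notin [:: 0; 1; -1; i; - i]) f w.
Proof.
have neqN (x : F) : x != 0 -> (x == - x) = false.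
  by move=> x0; rewrite -addr_eq0 -mulr2n -mulr_natr mulf_eq0 (negPf x0) (negPf two_neq0).
have i0 := imag_neq0.
have i1 : i != 1.
  by apply: contraNneq neg1_neq1 => i1; rewrite -i_sqr i1 expr1n.
have iN1 : i != -1.
  by apply: contraNneq neg1_neq1 => iE; rewrite -i_sqr iE sqrrN expr1n.
have uniq5 : uniq [:: 0; 1; -1; i; - i].
  rewrite /= !inE !negb_or ![0 == _]eq_sym !oppr_eq0 oner_eq0 i0 /=.
  rewrite !neqN ?oner_eq0 // ![_ == i]eq_sym i1 iN1 eqr_opp ![_ == - i]eq_sym.
by rewrite eqr_oppLR iN1 eq_sym i1.
rewrite (bigID (mem [:: 0; 1; -1; i; - i])) /= -(big_uniq _ uniq5).
by rewrite !big_cons big_nil /= addr0 !addrA.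
Qed.

(** The function [(w + 1 / w) ^ 2] separates the orbits of the group generated by negation and
    inversion, so it can index a partition into these orbits. *)
Lemma joukowski_fiber (w w0 : F) : w != 0 -> w0 != 0 ->
  ((w + w^-1) ^+ 2 == (w0 + w0^-1) ^+ 2) = (w \in [:: w0; - w0; w0^-1; - w0^-1]).
Proof.
move=> wn w0n; rewrite -subr_eq0.
have -> : (w + w^-1) ^+ 2 - (w0 + w0^-1) ^+ 2 =
    (w - w0) * (w + w0) * (w - w0^-1) * (w + w0^-1) * w^-1 ^+ 2.
  by field; rewrite wn w0n.
rewrite !mulf_eq0 invr_eq0 !(negPf wn) !subr_eq0 !addr_eq0 /= orbF !inE.
by rewrite -!orbA.
Qed.

(* On 0, 1, -1, i, -i the summand is 0, sg 2, sg 2, 0, 0; the remaining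
   arguments fall into fibres {w, -w, 1/w, -1/w} on which it is constant,
   equal to 1 or -1. *)
Lemma jac1_mod8 : sg (-1) = 1 -> (8 %| jac 1%R - (2 * sg 2%R + q%:Z - 5))%Z.
Proof.
move=> eps; pose f w := sg w * sg (w ^+ 2 + 1).
have := sum_split_mu4 (fun=> 1); rewrite sum_one => qE.
have := sum_split_mu4 f.
have i2 : i ^+ 2 + 1 = 0 by rewrite i_sqr addNr.
have -> : f 0 = 0 by rewrite /f sigma0 mul0r.
have -> : f 1 = sg 2%:R by rewrite /f sigma1 mul1r expr1n.
have -> : f (-1) = sg 2%:R by rewrite /f eps mul1r sqrrN expr1n.
have -> : f i = 0 by rewrite /f i2 sigma0 mulr0.
have -> : f (- i) = 0 by rewrite /f sqrrN i2 sigma0 mulr0.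
rewrite -[\sum_w f w]/(jac 1) => ->; rewrite qE.
pose D (w : F) := w \notin [:: 0; 1; -1; i; - i].
set S := \sum_(w | D w) f w; set n := \sum_(w | D w) 1.
have -> : 0 + sg 2%:R + sg 2%:R + 0 + 0 + S - (2 * sg 2%:R + (1 + 1 + 1 + 1 + 1 + n) - 5)
    = S - n by ring.
(* It suffices that the sum of [f w - 1] over each fibre is divisible by 8: its four terms are
   equal, and each is [0] or [-2]. *)
rewrite -sumrB (partition_big (fun w => (w + w^-1) ^+ 2) xpredT) //=.
apply: rpred_sum => c _.
have [w0 /andP[Dw0 /eqP w0c]|none] := pickP (fun w => D w && ((w + w^-1) ^+ 2 == c)); last first.
  by rewrite big_pred0 ?dvdz0.
have DE w : D w = [&& w != 0, w ^+ 2 != 1 & w ^+ 2 + 1 != 0].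
  have -> : (w ^+ 2 + 1 == 0) = (w == i) || (w == - i).
    by rewrite addr_eq0 -eqf_sqr i_sqr.
  by rewrite /D !inE sqrf_eq1 !negb_or -!andbA.
have w00 : w0 != 0 by move: Dw0; rewrite DE => /and3P[].
have w02 : w0 ^+ 2 != 1 by move: Dw0; rewrite DE => /and3P[].
have w02' : w0 ^+ 2 + 1 != 0 by move: Dw0; rewrite DE => /and3P[].
pose r := [:: w0; - w0; w0^-1; - w0^-1].
have uniq_r : uniq r.
  have neqN (x : F) : x != 0 -> (x == - x) = false.
    by move=> x0; rewrite -addr_eq0 -mulr2n -mulr_natr mulf_eq0 (negPf x0) (negPf two_neq0).
  have neqV : (w0 == w0^-1) = false.
    by apply: contraNF w02 => /eqP w0E; rewrite expr2 {2}w0E mulfV.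
  have neqNV : (w0 == - w0^-1) = false.
    by apply: contraNF w02' => /eqP w0E; rewrite expr2 {2}w0E mulrN mulfV // addNr.
  by rewrite /= !inE !negb_or eqr_oppLR eqr_opp !neqN ?invr_eq0 // neqV neqNV.
rewrite (eq_bigl (mem r)); last first.
  move=> w /=; have [->|w_neq0] := eqVneq w 0.
    by rewrite DE eqxx !inE ![0 == _]eq_sym !oppr_eq0 invr_eq0 (negPf w00).
  rewrite -w0c joukowski_fiber // -/r.
  case wr : (w \in r); rewrite ?andbF ?andbT //.
  have w2E : w ^+ 2 = w0 ^+ 2 \/ w ^+ 2 = w0 ^- 2.
    move: wr; rewrite !inE => /or4P[] /eqP ->; rewrite ?sqrrN ?exprVn; by [left|right].
  rewrite DE w_neq0 /=; case: w2E => ->; first by rewrite w02 w02'.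
  rewrite invr_eq1 w02 /= -[1](mulVf (expf_neq0 2 w00)) -[X in X + _]mulr1 -mulrDr.
  by rewrite mulf_neq0 ?invr_eq0 ?expf_neq0 // addrC.
rewrite -(big_uniq _ uniq_r) !big_cons big_nil /= addr0.
have fN w : f (- w) = f w by rewrite /f sqrrN -mulN1r sigmaM eps mul1r.
have fV : f w0^-1 = f w0.
  rewrite /f sigmaV; congr (_ * _).
  have -> : w0^-1 ^+ 2 + 1 = w0^-1 ^+ 2 * (w0 ^+ 2 + 1) by field.
  by rewrite sigmaM sigma_sqr invr_eq0 w00 mul1r.
rewrite !fN fV.
have : f w0 != 0 by rewrite mulf_neq0 ?sigma_eq0.
rewrite /f -sigmaM; case: (sigma_val (w0 * (w0 ^+ 2 + 1))) => ->; lia.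
Qed.

End FourthRootOfUnity.

(** Here [(q - 1) / 2 = 2 k] and [i ^ (2 k) = (-1) ^ k]. Together with [sigma_imag] this is the
    second supplementary law for [q = 1] mod 4. *)
Lemma sigma_imag_val i k : i ^+ 2 = -1 -> q = (4 * k).+1 -> sg i = (-1) ^+ k.
Proof.
move=> i_sqr qE; apply: sigma_sign_val.
by rewrite qE (_ : _./2 = 2 * k)%N ?exprM ?i_sqr //; lia.
Qed.

(** With [q = 4 k + 1], [jac1_mod8] reads [jac 1 = 2 (-1) ^ k + 4 k - 4] mod 8, which is [-2] for
    either parity of [k]; hence [A = -1] mod 4. The other square comes from [jac g] for a nonresidue
    [g]. *)
Lemma jac_two_squares_A : (q = 1 %[mod 4])%N ->
  exists2 A : int, jac 1 = 2 * A & (exists B : int, q%:Z = A ^+ 2 + B ^+ 2) /\ (A = -1 %[mod 4])%Z.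
Proof.
move=> q1.
pose k := (q %/ 4)%N.
have qE : q = (4 * k).+1 by move: q1; rewrite /k; lia.
have eps : sg (-1) = 1.
  by rewrite sigmaN1 qE (_ : _./2 = 2 * k)%N ?exprM ?sqrrN ?expr1n //; lia.
have [i i0 /esym i_sqr] := sigma_eq1 eps.
have := jac1_mod8 i_sqr eps.
rewrite -(sigma_imag i_sqr) (sigma_imag_val i_sqr qE) -signr_odd => J8.
have [g g_nr] := exists_nonresidue.
have := jac_two_squares eps g_nr.
set J := jac 1 in J8 *; set H := jac g => JH.
have [A JA A3] : exists2 A : int, J = 2 * A & (A = -1 %[mod 4])%Z.
  exists (J %/ 2)%Z; move: J8; case odd_k: (odd k); rewrite ?expr0 ?expr1; lia.
exists A => //; split => //; exists (H %/ 2)%Z.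
have [B [HB|HB]] : exists B, H = 2 * B \/ H = 2 * B + 1 by exists (H %/ 2)%Z; lia.
  rewrite HB in JH *; rewrite JA in JH.
  have -> : ((2 * B) %/ 2)%Z = B by lia.
  move: JH; rewrite !exprMn; lia.
(* An odd [H] would make [4 q] odd, since [J] is even. *)
exfalso; move: JH; rewrite JA HB sqrrD exprMn exprMn mulr1 expr1n; lia.
Qed.

(** For [a != 0] this counts the square roots of [c / a]; the last two terms correct the case
    [a = 0], where there are [q] or no solutions. *)
Lemma count_quad a c :
  \sum_(x : F) (a * x ^+ 2 == c)%:R =
  (1 + sg (a * c) - (a == 0)%:R + q%:Z * ((a == 0) && (c == 0))%:R)%R :> int.
Proof.
have [->|a0] := eqVneq a 0.
  rewrite mul0r sigma0 addr0 subrr add0r -sum_one mulr_suml.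
  by apply: eq_bigr => x _; rewrite mul0r mul1r eq_sym.
rewrite subr0 mulr0 addr0 (_ : sg (a * c) = sg (c / a)); last first.
  by rewrite !sigmaM sigmaV mulrC.
rewrite -count_sqrt; apply: eq_bigr => x _; congr (_%:R); congr nat_of_bool.
by apply/eqP/eqP => [<-|->]; field.
Qed.

Lemma exists_imag : sg (-1) = 1 -> exists i : F, i ^+ 2 = -1.
Proof. by move=> /sigma_eq1[i _ ->]; exists i. Qed.

Lemma sigmaN1_val : sg (-1) = 1 \/ sg (-1) = -1.
Proof. by rewrite sigmaN1 -signr_odd; case: odd; [right|left]. Qed.

Lemma natr_andb (b1 b2 : bool) : (b1 && b2)%:R = b1%:R * b2%:R :> int.
Proof. by case: b1; rewrite ?mul1r ?mul0r. Qed.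

(** * Counting the solutions of the Vieta equation *)

Section Counting.
Variable E : F.
Hypothesis E_neq0 : E != 0.

Definition jac4 : int := \sum_(x : F) sg (E ^+ 2 * x ^+ 4 + 1).

Lemma jac4E : jac4 = sg E * jac 1 - 1.
Proof. by rewrite /jac4 sum_sigma_quartic // oner_eq0 mulr0 add0r addrC. Qed.

(** As a quadratic in [t], the equation has quarter discriminant [(E ^ 2 x ^ 2 y ^ 2 - 1) z ^ 2 - (x
    ^ 2 + y ^ 2)]. On [isotropic] its constant coefficient in [z] vanishes, on [hyperbola] its
    leading one. *)
Definition isotropic x y := x ^+ 2 + y ^+ 2 == 0.
Definition hyperbola x y := E ^+ 2 * x ^+ 2 * y ^+ 2 - 1 == 0.

Lemma count_isotropic :
  \sum_(x : F) \sum_(y : F) (isotropic x y)%:R = q%:Z + (q%:Z - 1) * sg (-1).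
Proof.
transitivity (\sum_(x : F) (1 + sg (- 1 * x ^+ 2 + 0))).
  apply: eq_bigr => x _; rewrite addr0 mulN1r -count_sqrt; apply: eq_bigr => y _.
  by rewrite /isotropic addrC addr_eq0.
rewrite big_split /= sum_one sum_sigma_quad oppr_eq0 oner_eq0 eqxx /=; ring.
Qed.

(** A nonzero [x] has [1 + sg (-1)] partners [y], while [x = 0] has only [y = 0]; the last term
    corrects for this. *)
Lemma sum_isotropic (f : F -> int) :
  \sum_(x : F) \sum_(y : F) (isotropic x y)%:R * f x =
  (1 + sg (-1)) * \sum_(x : F) f x - sg (-1) * f 0.
Proof.
transitivity (\sum_(x : F) (1 + sg (- x ^+ 2)) * f x).
  apply: eq_bigr => x _; rewrite -count_sqrt mulr_suml; apply: eq_bigr => y _.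
  by rewrite /isotropic addrC addr_eq0.
rewrite (bigD1 (0 : F)) // [in RHS](bigD1 (0 : F)) //= expr0n oppr0 sigma0.
rewrite (eq_bigr (fun x => (1 + sg (-1)) * f x)) => [|x x0].
  by rewrite -mulr_sumr; ring.
by rewrite -[- x ^+ 2]mulN1r [sg (-1 * _)]sigmaM sigma_sqr x0 mulr1.
Qed.

(** Each nonzero [x] has the two partners [1 / (E x)] and [- 1 / (E x)], and [x = 0] has none. *)
Lemma sum_hyperbola (f : F -> int) :
  \sum_(x : F) \sum_(y : F) (hyperbola x y)%:R * f x = 2 * \sum_(x : F | x != 0) f x.
Proof.
rewrite (bigD1 (0 : F)) //= big1 => [|y _]; last first.
  by rewrite /hyperbola expr0n mulr0 mul0r sub0r oppr_eq0 oner_eq0 mul0r.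
rewrite add0r mulr_sumr; apply: eq_bigr => x x0; rewrite -mulr_suml; congr (_ * _).
under eq_bigr do rewrite /hyperbola subr_eq0.
rewrite count_quad mulr1 -exprMn sigma_sqr mulf_neq0 //.
rewrite expf_eq0 mulf_eq0 (negPf E_neq0) (negPf x0) /=; ring.
Qed.

Lemma count_hyperbola :
  \sum_(x : F) \sum_(y : F) (hyperbola x y)%:R = 2 * (q%:Z - 1).
Proof.
rewrite -sum_one_nz -(sum_hyperbola (fun=> 1)).
by apply: eq_bigr => x _; apply: eq_bigr => y _; rewrite mulr1.
Qed.

(** This number governs the low degrees: there turn out to be [8 * W] vertices of degree 1. *)
Definition isotropic_hyperbola : int :=
  \sum_(x : F) \sum_(y : F) (isotropic x y && hyperbola x y)%:R.
Local Notation W := isotropic_hyperbola.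

(** Substituting [y ^ 2 = - x ^ 2] leaves a condition on [x] alone. It fails at [x = 0], so the
    correction in [sum_isotropic] vanishes. *)
Lemma isotropic_hyperbolaE :
  W = (1 + sg (-1)) * \sum_(x : F) (- E ^+ 2 * x ^+ 4 == 1)%:R.
Proof.
have := sum_isotropic (fun x => (- E ^+ 2 * x ^+ 4 == 1)%:R).
rewrite expr0n mulr0 [0 == 1]eq_sym oner_eq0 mulr0 subr0 => <-.
apply: eq_bigr => x _; apply: eq_bigr => y _; rewrite /hyperbola.
case isot: (isotropic x y) => /=; last by rewrite mul0r.
rewrite mul1r subr_eq0; congr ((_ == _)%:R).
move: isot; rewrite /isotropic addrC addr_eq0 => /eqP ->; ring.
Qed.

Lemma isotropic_hyperbola_odd : sg (-1) = -1 -> W = 0.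
Proof. by move=> eps; rewrite isotropic_hyperbolaE eps mul0r. Qed.

(** The quartic condition splits into [x ^ 2 = i / E] and [x ^ 2 = - i / E], each with
    [1 + sg (i E) = 1 + sg (2 E)] roots. *)
Lemma isotropic_hyperbola_even : sg (-1) = 1 -> W = 4 * (1 + sg (2%:R * E)).
Proof.
move=> eps; have [i i_sqr] := exists_imag eps.
rewrite isotropic_hyperbolaE eps.
have -> : \sum_(x : F) (- E ^+ 2 * x ^+ 4 == 1)%:R =
  \sum_(x : F) ((x ^+ 2 == i / E)%:R + (x ^+ 2 == - (i / E))%:R) :> int.
  apply: eq_bigr => x _.
  have -> : (- E ^+ 2 * x ^+ 4 == 1) = (x ^+ 2 == i / E) || (x ^+ 2 == - (i / E)).
    rewrite -eqf_sqr [(i / E) ^+ 2]exprMn i_sqr -exprM exprVn mulN1r -subr_eq0 -[RHS]subr_eq0.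
    have -> : - E ^+ 2 * x ^+ 4 - 1 = - E ^+ 2 * (x ^+ (2 * 2) - - E ^- 2) by field.
    by rewrite mulf_eq0 oppr_eq0 expf_eq0 (negPf E_neq0).
  have iEN : (i / E == - (i / E)) = false.
    rewrite -addr_eq0 -mulr2n -mulr_natr !mulf_eq0 invr_eq0 (negPf E_neq0).
    by rewrite (negPf two_neq0) (negPf (imag_neq0 i_sqr)).
  by have [->|_] := eqVneq (x ^+ 2) (i / E); rewrite ?iEN ?add0r.
rewrite big_split /= !count_sqrt -mulN1r !sigmaM eps mul1r sigmaV (sigma_imag i_sqr).
ring.
Qed.

Lemma count_completed_square (b c : F) :
  \sum_(t : F) (c + t ^+ 2 == 2%:R * b * t)%:R = 1 + sg (b ^+ 2 - c) :> int.
Proof.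
rewrite -count_sqrt (reindex_inj (@addIr F b)); apply: eq_bigr => t _ /=.
rewrite -subr_eq0 -[t ^+ 2 == _]subr_eq0; congr ((_ == _)%:R); ring.
Qed.

(** Completing the square counts [t], and [sum_sigma_quad] then sums over [z]. On either degenerate
    curve the surviving character value is [sg (- (E ^ 2 x ^ 4 + 1))], free of [y], which is how
    [jac4] enters. *)
Lemma sum_vieta :
  \sum_(x : F) \sum_(y : F) \sum_(z : F) \sum_(t : F)
    (x ^+ 2 + y ^+ 2 + z ^+ 2 + t ^+ 2 == 2%:R * E * x * y * z * t)%:R =
  (q%:Z ^+ 3 - 1 - 3 * q%:Z * sg (-1) + q%:Z * (1 + 3 * sg (-1)) * jac4)%R :> int.
Proof.
pose a x y := E ^+ 2 * x ^+ 2 * y ^+ 2 - 1.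
have inner x y : \sum_(z : F) \sum_(t : F)
    (x ^+ 2 + y ^+ 2 + z ^+ 2 + t ^+ 2 == 2%:R * E * x * y * z * t)%:R =
    (q%:Z - sg (a x y)
    + q%:Z * ((hyperbola x y)%:R * (sg (-1) * sg (E ^+ 2 * x ^+ 4 + 1))
            + (isotropic x y)%:R * (sg (-1) * sg (E ^+ 2 * x ^+ 4 + 1))))%R :> int.
  transitivity (\sum_(z : F) (1 + sg (a x y * z ^+ 2 + - (x ^+ 2 + y ^+ 2)))).
    apply: eq_bigr => z _.
    have -> : a x y * z ^+ 2 - (x ^+ 2 + y ^+ 2) =
              (E * x * y * z) ^+ 2 - (x ^+ 2 + y ^+ 2 + z ^+ 2) by rewrite /a; ring.
    by rewrite -count_completed_square; apply: eq_bigr => t _; rewrite !mulrA.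
  rewrite big_split /= sum_one sum_sigma_quad oppr_eq0.
  rewrite -/(hyperbola x y) -/(isotropic x y) addrA addrAC; congr (_ - _ + _ * (_ + _)).
    case hyp: (hyperbola x y); last by rewrite !mul0r.
    rewrite !mul1r -sigmaM; move: hyp; rewrite /hyperbola subr_eq0 => /eqP hyp.
    have x0 : x != 0.
      by apply: contra_eq_neq hyp => ->; rewrite expr0n mulr0 mul0r eq_sym oner_eq0.
    rewrite -[LHS]mul1r -[1](_ : sg ((E * x) ^+ 2) = 1); last first.
      by rewrite sigma_sqr mulf_neq0.
    rewrite -sigmaM; congr (sg _).
    transitivity (- (E ^+ 2 * x ^+ 4 + E ^+ 2 * x ^+ 2 * y ^+ 2)); first by ring.
    by rewrite hyp; ring.
  case isot: (isotropic x y); last by rewrite !mul0r.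
  rewrite !mul1r -sigmaM; congr (sg _).
  by move: isot; rewrite /isotropic addrC addr_eq0 /a => /eqP ->; ring.
under eq_bigr => x _.
  under eq_bigr do rewrite inner.
  rewrite !big_split /= -mulr_sumr big_split /= sumrN.
  over.
rewrite !big_split /= -!mulr_sumr big_split /= sumrN sum_hyperbola sum_isotropic.
have -> : \sum_(x : F) \sum_(y : F) q%:Z = q%:Z ^+ 3.
  transitivity (\sum_(x : F) \sum_(y : F) (1 : int) * q%:Z).
    by apply: eq_bigr => x _; apply: eq_bigr => y _; rewrite mul1r.
  by under eq_bigr do rewrite -mulr_suml sum_one; rewrite sumr_const -mulr_natr natz; ring.
have -> : \sum_(x : F) \sum_(y : F) sg (a x y) = q%:Z * sg (-1) - (q%:Z - 1).
  rewrite (bigD1 (0 : F)) //=.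
  rewrite (eq_bigr (fun=> sg (-1))); last first.
    by move=> y _; rewrite /a expr0n mulr0 mul0r sub0r.
  rewrite sumr_const -mulr_natr natz mulrC -sum_one_nz -sumrN; congr (_ + _).
  apply: eq_bigr => x x0; rewrite /a sum_sigma_quad oppr_eq0 oner_eq0 -exprMn.
  by rewrite expf_eq0 mulf_eq0 (negPf E_neq0) (negPf x0) sigma_sqr mulf_neq0 //=; ring.
rewrite -!mulr_sumr -/jac4 expr0n mulr0 add0r sigma1.
have -> : jac4 = 1 + \sum_(x : F | x != 0) sg (E ^+ 2 * x ^+ 4 + 1).
  by rewrite /jac4 (bigD1 (0 : F)) //= expr0n mulr0 add0r sigma1.
(* The two sides agree only modulo [sg (-1) ^ 2 = 1], hence the case split before [ring]. *)
by case: sigmaN1_val => ->; ring.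
Qed.

Lemma sum_const_nz (n : int) : \sum_(a : F | a != 0) n = (q%:Z - 1) * n.
Proof. by rewrite -sum_one_nz mulr_suml; apply: eq_bigr => a _; rewrite mul1r. Qed.

(** * Sums over the four coordinates, and points fixed by given flips *)

Definition sum4 (G : F -> F -> F -> F -> int) : int :=
  \sum_(x : F) \sum_(y : F) \sum_(z : F) \sum_(t : F) G x y z t.

Lemma eq_sum4 G H : (forall x y z t, G x y z t = H x y z t) -> sum4 G = sum4 H.
Proof.
by move=> GH; do 3!(apply: eq_bigr => ? _); apply: eq_bigr => ? _; exact: GH.
Qed.

Lemma sum4_swap12 G : sum4 (fun x y z t => G y x z t) = sum4 G.
Proof. exact: exchange_big. Qed.

Lemma sum4_swap23 G : sum4 (fun x y z t => G x z y t) = sum4 G.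
Proof. by apply: eq_bigr => x _; exact: exchange_big. Qed.

Lemma sum4_swap34 G : sum4 (fun x y z t => G x y t z) = sum4 G.
Proof. by apply: eq_bigr => x _; apply: eq_bigr => y _; exact: exchange_big. Qed.

Definition vieta x y z t :=
  x ^+ 2 + y ^+ 2 + z ^+ 2 + t ^+ 2 == 2%:R * E * x * y * z * t.

Definition fixes_last x y z t := t == E * x * y * z.

(** The indicators are built as successive products so that [sum_fixed2_inner] can treat the next
    condition as a weight. *)
Definition fixed1 x y z t : int := (vieta x y z t && fixes_last x y z t)%:R.
Definition fixed2 x y z t : int := fixed1 x y z t * (fixes_last x y t z)%:R.
Definition fixed3 x y z t : int := fixed2 x y z t * (fixes_last x z t y)%:R.
Definition fixed4 x y z t : int := fixed3 x y z t * (fixes_last y z t x)%:R.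

(** Putting [t = E x y z] turns the equation into [a z ^ 2 = c], which [count_quad] counts. What
    remains is the sum of [sg (a c)] over [x] and [y], which a change of variable separates into
    Jacobsthal sums. *)
Lemma sum_fixed1 :
  sum4 fixed1 = q%:Z ^+ 2 - 2 * (q%:Z - 1) + q%:Z * W
    + 2 * (q%:Z - 1) * sg (-1) + 2 * (1 + sg (-1)) + sg E * jac (-1) * jac 1.
Proof.
pose a x y := E ^+ 2 * x ^+ 2 * y ^+ 2 - 1; pose c x y := x ^+ 2 + y ^+ 2.
transitivity (\sum_(x : F) \sum_(y : F) \sum_(z : F) (a x y * z ^+ 2 == c x y)%:R : int).
  apply: eq_bigr => x _; apply: eq_bigr => y _; apply: eq_bigr => z _.
  rewrite (bigD1 (E * x * y * z)) //= big1 => [|t tE]; last first.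
    by rewrite /fixed1 /fixes_last (negPf tE) andbF.
  rewrite addr0 /fixed1 /fixes_last eqxx andbT /vieta /a /c; congr (_%:R); congr nat_of_bool.
  by rewrite -subr_eq0 -[RHS]subr_eq0 -oppr_eq0; congr (_ == 0); ring.
under eq_bigr => x _.
  under eq_bigr => y _.
    rewrite count_quad -/(hyperbola x y) -/(isotropic x y) andbC.
    over.
  rewrite !big_split /= sum_one sumrN -mulr_sumr.
  over.
rewrite !big_split /= sumrN count_hyperbola -mulr_sumr -/W.
have -> : \sum_(x : F) q%:Z = q%:Z ^+ 2 by rewrite sumr_const -mulr_natr natz expr2.
suff -> : \sum_(x : F) \sum_(y : F) sg (a x y * c x y) =
    2 * (q%:Z - 1) * sg (-1) + 2 * (1 + sg (-1)) + sg E * jac (-1) * jac 1 by ring.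
have ac0 y : y != 0 -> sg (a 0 y * c 0 y) = sg (-1).
  move=> y0; rewrite /a /c expr0n mulr0 mul0r sub0r add0r sigmaM sigma_sqr y0.
  by rewrite mulr1.
rewrite (bigD1 (0 : F)) //= (bigD1 (0 : F)) //= (eq_bigr _ ac0) /a /c.
rewrite expr0n addr0 mulr0 sigma0 add0r sum_const_nz.
(* With [y = x u] the argument becomes [x ^ 2 (u ^ 2 + 1) (E ^ 2 u ^ 2 x ^ 4 - 1)], whose square
   factor drops out. *)
have -> : \sum_(x : F | x != 0) \sum_(y : F)
    sg ((E ^+ 2 * x ^+ 2 * y ^+ 2 - 1) * (x ^+ 2 + y ^+ 2)) =
  \sum_(x : F | x != 0) \sum_(u : F)
    sg (u ^+ 2 + 1) * sg ((E * u) ^+ 2 * x ^+ 4 - 1).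
  apply: eq_bigr => x x0; rewrite (reindex_inj (mulfI x0)); apply: eq_bigr => u _ /=.
  rewrite -sigmaM -[RHS]mul1r.
  have <- : sg (x ^+ 2) = 1 by rewrite sigma_sqr x0.
  by rewrite -sigmaM; congr (sg _); ring.
rewrite exchange_big /=.
(* The quartic sum over all [x], less its term [sg (-1)] at [x = 0]. *)
have inner u : u != 0 -> \sum_(x : F | x != 0) sg (u ^+ 2 + 1) * sg ((E * u) ^+ 2 * x ^+ 4 - 1) =
    (- 1 - sg (-1)) * sg (u ^+ 2 + 1) + sg E * jac (-1) * (sg u * sg (u ^+ 2 + 1)).
  move=> u0; rewrite -mulr_sumr.
  have := sum_sigma_quartic (-1) (mulf_neq0 E_neq0 u0).
  rewrite (bigD1 (0 : F)) //= expr0n mulr0 add0r oppr_eq0 oner_eq0 mulr0 add0r sigmaM.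
  by move=> /(canRL (addKr _)) ->; ring.
rewrite (bigD1 (0 : F)) //= (eq_bigr _ inner) big_split /= -!mulr_sumr.
under eq_bigr do rewrite mulr0 expr0n mul0r sub0r.
rewrite sum_const_nz expr0n add0r sigma1.
have := sum_sigma_sqr_shift 1.
rewrite (bigD1 (0 : F)) //= expr0n add0r sigma1 oner_eq0 mulr0 sub0r => /(canRL (addKr _)) ->.
have -> : \sum_(u : F | u != 0) sg u * sg (u ^+ 2 + 1) = jac 1.
  by rewrite /jac [RHS](bigD1 (0 : F)) //= sigma0 mul0r add0r.
ring.
Qed.

(** The equation reads [x ^ 2 + y ^ 2 + z (z - E x y t) + t (t - E x y z) = 0], and the two fixing
    conditions cancel the last two terms. *)
Lemma eq_fixed2 x y z t :
  fixed2 x y z t = (isotropic x y)%:R * ((t == E * x * y * z) && (z == E * x * y * t))%:R.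
Proof.
rewrite /fixed2 /fixed1 /fixes_last -!natr_andb; congr (_%:R); congr nat_of_bool.
case tE: (t == _); case zE: (z == _); rewrite ?andbF ?andbT //.
rewrite /vieta /isotropic -subr_eq0; congr (_ == 0).
transitivity (x ^+ 2 + y ^+ 2 + z * (z - E * x * y * t) + t * (t - E * x * y * z)); first by ring.
by rewrite -(eqP tE) -(eqP zE) !subrr !mulr0 !addr0.
Qed.

(** Eliminating [t = E x y z] from [z = E x y t] leaves [(E ^ 2 x ^ 2 y ^ 2 - 1) z = 0]: any [z] on
    the hyperbola, only [z = 0] off it. *)
Lemma sum_fixed2_inner x y (G : F -> F -> int) :
  \sum_(z : F) \sum_(t : F) fixed2 x y z t * G z t =
  (isotropic x y)%:R * \sum_(z : F | (hyperbola x y) || (z == 0)) G z (E * x * y * z).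
Proof.
rewrite mulr_sumr [RHS]big_mkcond; apply: eq_bigr => z _.
rewrite (bigD1 (E * x * y * z)) //= big1 => [|t tE]; last first.
  by rewrite eq_fixed2 (negPf tE) mulr0 mul0r.
rewrite addr0 eq_fixed2 eqxx /= /hyperbola.
have -> : (z == E * x * y * (E * x * y * z)) = (E ^+ 2 * x ^+ 2 * y ^+ 2 - 1 == 0) || (z == 0).
  by rewrite -mulf_eq0 eq_sym -subr_eq0; congr (_ == 0); ring.
by case: (_ || _); rewrite ?mulr1 ?mulr0 ?mul0r.
Qed.

Lemma sum_fixed2 : sum4 fixed2 = q%:Z + (q%:Z - 1) * sg (-1) + (q%:Z - 1) * W.
Proof.
rewrite -count_isotropic /W mulr_sumr -big_split; apply: eq_bigr => x _.
rewrite mulr_sumr -big_split; apply: eq_bigr => y _ /=.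
transitivity (\sum_(z : F) \sum_(t : F) fixed2 x y z t * 1).
  by do 2!(apply: eq_bigr => ? _); rewrite mulr1.
rewrite (sum_fixed2_inner x y (fun _ _ => 1)) natr_andb.
case: (hyperbola x y) => /=; first by rewrite sum_one; ring.
by rewrite (big_pred1 0) // !mulr0 addr0 mulr1.
Qed.

(** Off the hyperbola [z = t = 0], which forces [y = 0] and leaves only the origin. On it, the third
    condition amounts to [z ^ 2 = y ^ 2] with [y != 0], giving two values of [z]. *)
Lemma sum_fixed3 : sum4 fixed3 = 1 + 2 * W.
Proof.
transitivity (\sum_(x : F) \sum_(y : F) ((isotropic x y)%:R * (y == 0)%:R
    + 2 * (isotropic x y && hyperbola x y)%:R : int)).
  apply: eq_bigr => x _; apply: eq_bigr => y _.
  rewrite (sum_fixed2_inner x y (fun z t => (y == E * x * z * t)%:R)) natr_andb.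
  case hyp: (hyperbola x y) => /=; last by rewrite (big_pred1 0) // !mulr0 addr0.
  move: hyp; rewrite /hyperbola subr_eq0 => /eqP hyp.
  have y0 : y != 0.
    by apply: contra_eq_neq hyp => ->; rewrite expr0n mulr0 eq_sym oner_eq0.
  rewrite (negPf y0) mulr0 add0r mulr1 mulrC; congr (_ * _).
  transitivity (1 + sg (y ^+ 2)); last by rewrite sigma_sqr y0.
  rewrite -count_sqrt; apply: eq_bigr => z _; congr (_%:R); congr nat_of_bool.
  rewrite -(inj_eq (mulfI y0)) -expr2 eq_sym; congr (_ == _).
  by transitivity (E ^+ 2 * x ^+ 2 * y ^+ 2 * z ^+ 2); [ring | rewrite hyp mul1r].
under eq_bigr do rewrite big_split /= -mulr_sumr.
rewrite big_split /= -mulr_sumr; congr (_ + _).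
have iso0 (x : F) : \sum_(y : F) (isotropic x y)%:R * (y == 0)%:R = ((x == 0)%:R)%R :> int.
  rewrite (bigD1 (0 : F)) //= big1 => [|y /negPf->]; last by rewrite mulr0.
  by rewrite eqxx mulr1 addr0 /isotropic expr0n addr0 expf_eq0.
rewrite (eq_bigr _ (fun x _ => iso0 x)) (bigD1 (0 : F)) //= eqxx big1 ?addr0 //.
by move=> x /negPf->.
Qed.

(** The conditions make [x ^ 2] and [y ^ 2] both equal to [E x y z t]; since [x ^ 2 + y ^ 2 = 0] as
    well, [2 x ^ 2 = 0]. *)
Lemma eq_fixed4 x y z t :
  fixed4 x y z t = ([&& x == 0, y == 0, z == 0 & t == 0])%:R.
Proof.
rewrite /fixed4 /fixed3 eq_fixed2 /fixes_last -!natr_andb; congr (_%:R); congr nat_of_bool.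
apply/idP/idP => [|/and4P[/eqP-> /eqP-> /eqP-> /eqP->]]; last first.
  by rewrite /isotropic expr0n !mulr0 addr0 !eqxx.
case/andP => /andP[/and3P[iso /eqP tE /eqP zE] /eqP yE] /eqP xE.
have xy : x ^+ 2 = y ^+ 2.
  transitivity (x * (E * y * z * t)); first by rewrite -xE expr2.
  by transitivity (y * (E * x * z * t)); [ring | rewrite -yE expr2].
have x0 : x = 0.
  move: iso; rewrite /isotropic -xy -mulr2n -mulr_natr mulf_eq0 (negPf two_neq0).
  by rewrite orbF expf_eq0 => /eqP.
have y0 : y = 0 by apply/eqP; rewrite -[_ == 0]/(andb true _) -(expf_eq0 y 2) -xy x0 expr0n.
by rewrite tE zE x0 y0 !mulr0 !mul0r eqxx.
Qed.

Lemma sum_fixed4 : sum4 fixed4 = 1.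
Proof.
rewrite (eq_sum4 eq_fixed4) /sum4.
have delta (f : F -> int) : \sum_(x : F) (x == 0)%:R * f x = f 0.
  rewrite (bigD1 (0 : F)) //= eqxx mul1r big1 ?addr0 // => x /negPf->.
  exact: mul0r.
transitivity (\sum_(x : F) (x == 0)%:R * (\sum_(y : F) (y == 0)%:R *
    (\sum_(z : F) (z == 0)%:R * (\sum_(t : F) (t == 0)%:R * (1 : int))))); last by rewrite !delta.
do 3!(apply: eq_bigr => ? _; rewrite !mulr_sumr); apply: eq_bigr => ? _.
by rewrite !natr_andb mulr1.
Qed.
End Counting.
End QuadraticCharacter.

(** * Vertex degrees and binomial moments *)

Section Degrees.
Variable F : finFieldType.
Hypothesis odd_card : odd #|F|.
Variable E : F.

Local Notation V := (vieta E).
Local Notation fixes := (fixes_last E).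

Definition count_fixed x y z t : nat :=
  (fixes y z t x + fixes x z t y + fixes x y t z + fixes x y z t)%N.

Lemma vieta_flipE (m a : F) : (2%:R * m - a == a) = (a == m).
Proof.
rewrite -subr_eq0 -[RHS]subr_eq0 -oppr_eq0.
have -> : - (2%:R * m - a - a) = 2%:R * (a - m) by ring.
by rewrite mulf_eq0 (negPf (odd_card_two_neq0 odd_card)).
Qed.

(** Each flip is an involution. *)
Lemma vieta_flips_sym v w : (v \in vieta_flips E w) -> w \in vieta_flips E v.
Proof.
case: v w => [[[x y] z] t] [[[x' y'] z'] t'].
rewrite /vieta_flips !inE !xpair_eqE.
case/or4P=> /andP[/andP[/andP[/eqP-> /eqP->] /eqP->] /eqP->]; rewrite !eqxx ?andbT /=;
  apply/or4P; [constructor 1|constructor 2|constructor 3|constructor 4]; apply/eqP; ring.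
Qed.

(** A flip exchanges the two roots of the equation read as a quadratic in one coordinate. *)
Lemma vieta_flips_vertices v w :
  v \in vieta_vertices E -> w \in vieta_flips E v -> w \in vieta_vertices E.
Proof.
case: v w => [[[x y] z] t] [[[x' y'] z'] t'].
rewrite /vieta_flips !inE !xpair_eqE => vE.
by case/or4P=> /andP[/andP[/andP[/eqP-> /eqP->] /eqP->] /eqP->];
   rewrite -subr_eq0; move: vE; rewrite -subr_eq0 => /eqP vE; apply/eqP;
   rewrite -[RHS]vE; ring.
Qed.

(** The neighbours are the flips that move the vertex; these are pairwise distinct because they
    change different coordinates. *)
Lemma vieta_degreeE x y z t : (x, y, z, t) \in vieta_vertices E ->
  vieta_degree E (x, y, z, t) = (4 - count_fixed x y z t)%N.
Proof.
set v := (x, y, z, t) => vE.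
transitivity #|[seq w <- vieta_flips E v | w != v]|.
  apply: eq_card => w; rewrite inE mem_filter eq_sym /vieta_adj.
  have [->|vw] := eqVneq v w; first by rewrite andbF.
  apply/andP/andP => [[_ /orP[wv|/vieta_flips_sym wv]]|[_ wv]].
  - by [].
  - by [].
  - by split; [exact: vieta_flips_vertices vE wv | rewrite wv].
have e1 : 2%:R * E * y * z * t - x == x = fixes y z t x.
  by rewrite /fixes_last -[RHS]vieta_flipE !mulrA.
have e2 : 2%:R * E * x * z * t - y == y = fixes x z t y.
  by rewrite /fixes_last -[RHS]vieta_flipE !mulrA.
have e3 : 2%:R * E * x * y * t - z == z = fixes x y t z.
  by rewrite /fixes_last -[RHS]vieta_flipE !mulrA.
have e4 : 2%:R * E * x * y * z - t == t = fixes x y z t.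
  by rewrite /fixes_last -[RHS]vieta_flipE !mulrA.
rewrite /count_fixed -e1 -e2 -e3 -e4 /v /vieta_flips /=.
set x' := 2%:R * E * y * z * t - x; set y' := 2%:R * E * x * z * t - y.
set z' := 2%:R * E * x * y * t - z; set t' := 2%:R * E * x * y * z - t.
rewrite !xpair_eqE !eqxx !andbT /=.
case: (eqVneq x' x) => xx; case: (eqVneq y' y) => yy; case: (eqVneq z' z) => zz;
  case: (eqVneq t' t) => tt /=; rewrite (card_uniqP _) //= ?inE ?xpair_eqE ?negb_or ?negb_and.
all: by rewrite ?xx ?yy ?zz ?tt ?[x == _]eq_sym ?[y == _]eq_sym ?[z == _]eq_sym
  ?(negPf xx) ?(negPf yy) ?(negPf zz) ?(negPf tt) ?andbF ?orbT.
Qed.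

Lemma sum4D G H : sum4 (fun x y z t : F => G x y z t + H x y z t) = sum4 G + sum4 H.
Proof.
rewrite /sum4 -big_split; apply: eq_bigr => x _; rewrite -big_split; apply: eq_bigr => y _.
by rewrite -big_split; apply: eq_bigr => z _; rewrite -big_split.
Qed.

Lemma sum4Z n G : sum4 (fun x y z t : F => n * G x y z t) = n * sum4 G.
Proof.
rewrite /sum4 mulr_sumr; apply: eq_bigr => x _; rewrite mulr_sumr; apply: eq_bigr => y _.
by rewrite mulr_sumr; apply: eq_bigr => z _; rewrite mulr_sumr.
Qed.

Lemma card_sum4 (P : pred (point F)) :
  #|[set v | P v]|%:Z = sum4 (fun x y z t => (P (x, y, z, t))%:R).
Proof.
rewrite -sum1_card -natz natr_sum big_mkcond /sum4.
rewrite pair_bigA pair_bigA pair_bigA /=; apply: eq_bigr => -[[[x y] z] t] _ /=.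
by rewrite inE; case: (P _).
Qed.

Lemma card_vieta_vertices :
  #|vieta_vertices E|%:Z = sum4 (fun x y z t => (V x y z t)%:R).
Proof. exact: card_sum4. Qed.

(** The number of pairs formed by a vertex and a set of [k] flips that fix it. *)
Definition binomial_moment (k : nat) : int :=
  sum4 (fun x y z t => (V x y z t)%:R * 'C(count_fixed x y z t, k)%:R).

Lemma num_of_degreeE d : num_of_degree E d =
  sum4 (fun x y z t => (V x y z t)%:R * (d == 4 - count_fixed x y z t)%N%:R).
Proof.
rewrite /num_of_degree card_sum4; apply: eq_sum4 => x y z t.
have := @vieta_degreeE x y z t; rewrite !inE -[_ == _ * t]/(V x y z t).
case: (V x y z t) => /= [->|]; rewrite ?mul0r //.
by rewrite mul1r eq_sym.
Qed.

Lemma vieta_perm x y z t :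
  (V y x z t = V x y z t) * (V x z y t = V x y z t) *
  (V x y t z = V x y z t) * (V x z t y = V x y z t) *
  (V y z t x = V x y z t) * (V y z x t = V x y z t) *
  (V x t y z = V x y z t) * (V y t x z = V x y z t) *
  (V z t x y = V x y z t) * (V z x y t = V x y z t) *
  (V t x y z = V x y z t).
Proof.
by do !split; rewrite /vieta -subr_eq0 -[RHS]subr_eq0; congr (_ == 0); ring.
Qed.

Lemma fixes_last_perm x y z t :
  (fixes x z y t = fixes x y z t) * (fixes y x z t = fixes x y z t) *
  (fixes y z x t = fixes x y z t) * (fixes z x y t = fixes x y z t) *
  (fixes z y x t = fixes x y z t).
Proof. by do !split; rewrite /fixes_last; congr (_ == _); ring. Qed.

Lemma sum4_rot3 G : sum4 (fun x y z t : F => G x z t y) = sum4 G.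
Proof. by rewrite -[RHS]sum4_swap34 -[RHS]sum4_swap23. Qed.

Lemma sum4_rot3V G : sum4 (fun x y z t : F => G x t y z) = sum4 G.
Proof. by rewrite -[RHS]sum4_swap23 -[RHS]sum4_swap34. Qed.

(** Permuting coordinates shows that the four choices of a flip contribute equally; the next two
    moments use the six pairs and the four triples in the same way. *)
Lemma binomial_moment1 : binomial_moment 1 = 4 * sum4 (fixed1 E).
Proof.
transitivity (sum4 (fixed1 E) + sum4 (fun x y z t => fixed1 E x y t z)
  + sum4 (fun x y z t => fixed1 E x z t y) + sum4 (fun x y z t => fixed1 E y z t x)).
  rewrite -!sum4D; apply: eq_sum4 => x y z t; rewrite /fixed1 /count_fixed.
  rewrite !(vieta_perm x y z t); case: (V x y z t); rewrite ?mul0r //.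
  by do 4!case: (fixes _ _ _ _).
rewrite (sum4_swap12 (fun x y z t => fixed1 E x z t y)).
rewrite (sum4_swap34 (fixed1 E)) (sum4_rot3 (fixed1 E)); ring.
Qed.

Lemma binomial_moment2 : binomial_moment 2 = 6 * sum4 (fixed2 E).
Proof.
transitivity (sum4 (fixed2 E) + sum4 (fun x y z t => fixed2 E x z y t)
  + sum4 (fun x y z t => fixed2 E y z x t) + sum4 (fun x y z t => fixed2 E x t y z)
  + sum4 (fun x y z t => fixed2 E y t x z) + sum4 (fun x y z t => fixed2 E z t x y)).
  rewrite -!sum4D; apply: eq_sum4 => x y z t; rewrite /fixed2 /fixed1 /count_fixed.
  rewrite !(vieta_perm x y z t) !(fixes_last_perm x y z t) !(fixes_last_perm x y t z)
    !(fixes_last_perm x z t y) !(fixes_last_perm y z t x).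
  case: (V x y z t); rewrite ?mul0r //.
  by do 4!case: (fixes _ _ _ _).
rewrite (sum4_swap23 (fun x y z t => fixed2 E y t x z)).
rewrite (sum4_swap12 (fun x y z t => fixed2 E x z y t)) (sum4_swap23 (fixed2 E)).
rewrite (sum4_swap12 (fun x y z t => fixed2 E x t y z)) (sum4_rot3V (fixed2 E)); ring.
Qed.

Lemma binomial_moment3 : binomial_moment 3 = 4 * sum4 (fixed3 E).
Proof.
transitivity (sum4 (fixed3 E) + sum4 (fun x y z t => fixed3 E y x z t)
  + sum4 (fun x y z t => fixed3 E z x y t) + sum4 (fun x y z t => fixed3 E t x y z)).
  rewrite -!sum4D; apply: eq_sum4 => x y z t; rewrite /fixed3 /fixed2 /fixed1 /count_fixed.
  rewrite !(vieta_perm x y z t) !(fixes_last_perm x y z t) !(fixes_last_perm x y t z)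
    !(fixes_last_perm x z t y) !(fixes_last_perm y z t x).
  case: (V x y z t); rewrite ?mul0r //.
  by do 4!case: (fixes _ _ _ _).
rewrite (sum4_swap34 (fun x y z t => fixed3 E z x y t)).
rewrite (sum4_swap23 (fun x y z t => fixed3 E y x z t)) (sum4_swap12 (fixed3 E)); ring.
Qed.

Lemma binomial_moment4 : binomial_moment 4 = sum4 (fixed4 E).
Proof.
apply: eq_sum4 => x y z t; rewrite /fixed4 /fixed3 /fixed2 /fixed1 /count_fixed -!natr_andb.
by case: (V x y z t); do 4!case: (fixes _ _ _ _).
Qed.

(** Binomial inversion: a number [n <= 4] of fixing flips equals [1] exactly when
    [C(n,1) - 2 C(n,2) + 3 C(n,3) - 4 C(n,4)] is [1], and this expression is [0] otherwise. Degrees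
    2 and 1 use the analogous expressions. *)
Lemma num_of_degree3 : num_of_degree E 3 =
  4 * sum4 (fixed1 E) - 12 * sum4 (fixed2 E) + 12 * sum4 (fixed3 E) - 4 * sum4 (fixed4 E).
Proof.
transitivity (binomial_moment 1 + -2 * binomial_moment 2 + 3 * binomial_moment 3
  + -4 * binomial_moment 4); last first.
  rewrite binomial_moment1 binomial_moment2 binomial_moment3 binomial_moment4; ring.
rewrite num_of_degreeE -!sum4Z -!sum4D; apply: eq_sum4 => x y z t.
rewrite /count_fixed; case: (V x y z t); rewrite ?mul0r ?mulr0 //.
by do 4!case: (fixes _ _ _ _).
Qed.

Lemma num_of_degree2 : num_of_degree E 2 =
  6 * sum4 (fixed2 E) - 12 * sum4 (fixed3 E) + 6 * sum4 (fixed4 E).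
Proof.
transitivity (binomial_moment 2 + -3 * binomial_moment 3 + 6 * binomial_moment 4); last first.
  rewrite binomial_moment2 binomial_moment3 binomial_moment4; ring.
rewrite num_of_degreeE -!sum4Z -!sum4D; apply: eq_sum4 => x y z t.
rewrite /count_fixed; case: (V x y z t); rewrite ?mul0r ?mulr0 //.
by do 4!case: (fixes _ _ _ _).
Qed.

Lemma num_of_degree1 : num_of_degree E 1 = 4 * sum4 (fixed3 E) - 4 * sum4 (fixed4 E).
Proof.
transitivity (binomial_moment 3 + -4 * binomial_moment 4); last first.
  rewrite binomial_moment3 binomial_moment4; ring.
rewrite num_of_degreeE -!sum4Z -!sum4D; apply: eq_sum4 => x y z t.
rewrite /count_fixed; case: (V x y z t); rewrite ?mul0r ?mulr0 //.
by do 4!case: (fixes _ _ _ _).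
Qed.

Lemma num_of_degree0 : num_of_degree E 0 = sum4 (fixed4 E).
Proof.
rewrite -binomial_moment4 num_of_degreeE; apply: eq_sum4 => x y z t.
rewrite /count_fixed; case: (V x y z t); rewrite ?mul0r ?mulr0 //.
by do 4!case: (fixes _ _ _ _).
Qed.
End Degrees.

(** * Uniqueness of the representation as a sum of two squares *)

Lemma two_squares_unique (p : nat) (A B C D : int) : prime p ->
  p%:Z = A ^+ 2 + B ^+ 2 -> p%:Z = C ^+ 2 + D ^+ 2 -> A ^+ 2 = C ^+ 2 \/ A ^+ 2 = D ^+ 2.
Proof.
move=> p_prime pAB.
have p_gt0 : 0 < p%:Z by have := prime_gt0 p_prime; lia.
have p_neq0 : p%:Z != 0 by lia.
(* If [A D' - B C = k p], Brahmagupta's identity bounds [(k p) ^ 2] by [p ^ 2], so either [k = 0] or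
   [A C + B D' = 0]. Stated for any [D'], this serves both [D] and [- D]. *)
have dvd_case D' : (p%:Z %| A * D' - B * C)%Z -> p%:Z = C ^+ 2 + D' ^+ 2 ->
    A ^+ 2 = C ^+ 2 \/ A ^+ 2 = D' ^+ 2.
  case/dvdzP=> k kE pCD.
  have brahmagupta : (A * C + B * D') ^+ 2 + (k * p%:Z) ^+ 2 = p%:Z ^+ 2.
    rewrite -kE; transitivity ((A ^+ 2 + B ^+ 2) * (C ^+ 2 + D' ^+ 2)); first by ring.
    by rewrite -pAB -pCD.
  have [k0|k0] := eqVneq k 0.
    left; apply: (mulfI p_neq0); move: kE; rewrite k0 mul0r => /eqP; rewrite subr_eq0 => /eqP ADE.
    rewrite [in LHS]pCD mulrDl -!exprMn [D' * A]mulrC ADE !exprMn pAB; ring.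
  right; apply: (mulfI p_neq0).
  have k2 : 1 <= k ^+ 2 by have : 0 < k ^+ 2 by rewrite exprn_even_gt0.
  have ACE : A * C = - (B * D').
    have pk : p%:Z ^+ 2 <= (k * p%:Z) ^+ 2 by rewrite exprMn ler_peMl ?sqr_ge0.
    apply/eqP; rewrite -addr_eq0 -sqrf_eq0; move: brahmagupta pk (sqr_ge0 (A * C + B * D')); lia.
  rewrite [in LHS]pCD mulrDl -!exprMn [C * A]mulrC ACE sqrrN !exprMn pAB; ring.
move=> pCD.
(* The product of the two factors is [(A ^ 2 - C ^ 2) p], so the prime [p] divides one of them. *)
have : (p %| `|(A * D - B * C)%R| * `|(A * D + B * C)%R|)%N.
  rewrite -abszM -[p]/(`|p%:Z|%N) -dvdzE; apply/dvdzP; exists (A ^+ 2 - C ^+ 2).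
  transitivity (A ^+ 2 * (C ^+ 2 + D ^+ 2) - C ^+ 2 * (A ^+ 2 + B ^+ 2)); first by ring.
  by rewrite -pAB -pCD; ring.
rewrite Euclid_dvdM // => /orP[] dvd; first by apply: (dvd_case D); rewrite ?dvdzE.
rewrite -(sqrrN D); apply: dvd_case; last by rewrite sqrrN.
by rewrite mulrN -opprD dvdzE abszN.
Qed.

(** For a second candidate [C], [A ^ 2 = D ^ 2] would make [p] a sum of two odd squares, hence even;
    so [C] is [A] or [- A], and the congruence mod 4 fixes the sign. *)
Lemma A2E (p : nat) (A : int) : prime p -> (p = 1 %[mod 4])%N -> is_A2 p A -> A2 p = A.
Proof.
move=> p_prime p1 [[B pAB] A3]; apply: classical_sets.xget_unique; first by split; [exists B|].
move=> C [[D pCD] C3].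
have A2C : A ^+ 2 = C ^+ 2.
  have [//|AD] := two_squares_unique p_prime pAB pCD.
  exfalso; have [k kE] : exists k, A = 4 * k - 1 by exists ((A + 1) %/ 4)%Z; lia.
  have [l lE] : exists l, C = 4 * l - 1 by exists ((C + 1) %/ 4)%Z; lia.
  by move: pCD; rewrite -AD kE lE; lia.
have /eqP := A2C; rewrite eqf_sqr => /orP[/eqP//|/eqP AC].
by exfalso; lia.
Qed.

Theorem theorem16p2 (p : nat) (E : 'F_p) (p_prime : prime p) (p_ge5 : (5 <= p)%N)
    (E_neq0 : E != 0) :
  ((p = 3 %[mod 4])%N ->
     [/\ #|vieta_vertices E|%:Z = p%:Z ^+ 3 + 5 * p%:Z - 1,
         num_of_degree E 3 = 4 * (p%:Z ^+ 2 - 4 * p%:Z + 3),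
         num_of_degree E 2 = 0,
         num_of_degree E 1 = 0
       & num_of_degree E 0 = 1])
  /\
  ((p = 1 %[mod 4])%N ->
     [/\ #|vieta_vertices E|%:Z
           = p%:Z ^+ 3 - 7 * p%:Z - 1 + 8 * sigma E * A2 p * p%:Z,
         num_of_degree E 3
           = 4 * (p%:Z ^+ 2 - 14 * p%:Z + 45
                  + 4 * sigma (2%:R * E) * (A2 p ^+ 2 - 2 * p%:Z + 9)),
         num_of_degree E 2
           = 6 * (6 * p%:Z - 22 + 4 * sigma (2%:R * E) * (p%:Z - 5)),
         num_of_degree E 1 = 32 * (1 + sigma (2%:R * E))
       & num_of_degree E 0 = 1]).
Proof.
have cardF : #|'F_p| = p by rewrite card_Fp.
have odd_card : odd #|'F_p| by rewrite cardF; case: (even_prime p_prime) p_ge5 => [->|].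
have vertices := sum_vieta odd_card E_neq0.
rewrite (jac4E odd_card E_neq0) in vertices.
have M1 := sum_fixed1 odd_card E_neq0; have M2 := sum_fixed2 odd_card E.
have M3 := sum_fixed3 odd_card E; have M4 := sum_fixed4 odd_card E.
rewrite (num_of_degree3 odd_card) (num_of_degree2 odd_card) (num_of_degree1 odd_card)
  (num_of_degree0 odd_card) card_vieta_vertices.
rewrite -[X in X = _]/(sum4 (fun x y z t : 'F_p => (vieta E x y z t)%:R)) in vertices.
rewrite vertices M1 M2 M3 M4 cardF.
split=> p_mod.
  have eps : sigma (-1 : 'F_p) = -1.
    by rewrite (sigmaN1 odd_card) cardF -signr_odd (_ : odd _ = true) //; move: p_mod; lia.
  (* As [-1] is a nonsquare, [W] and all Jacobsthal sums vanish, so only polynomials in [p]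
     remain. *)
  rewrite eps (isotropic_hyperbola_odd odd_card E eps) !(jac_odd odd_card _ eps).
  by split; ring.
have q_mod : (#|'F_p| = 1 %[mod 4])%N by rewrite cardF.
have eps : sigma (-1 : 'F_p) = 1.
  by rewrite (sigmaN1 odd_card) cardF -signr_odd (_ : odd _ = false) //; move: p_mod; lia.
have [i i_sqr] := @exists_imag 'F_p eps.
(* Since [-1 = i ^ 2 * 1], twisting by [i] turns [sigma E * jac (-1) * jac 1] into
   [sigma (2 E) * jac 1 ^ 2], the source of the term [A2 p ^ 2]. *)
have jacN1 : jac (-1 : 'F_p) = sigma (2%:R : 'F_p) * jac (1 : 'F_p).
  by rewrite -(sigma_imag odd_card i_sqr) -jacM // mulr1 i_sqr.
have [A jacA isA] := jac_two_squares_A odd_card q_mod.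
have -> : A2 p = A by apply: A2E => //; rewrite -cardF.
rewrite eps (isotropic_hyperbola_even odd_card E_neq0 eps) jacN1 jacA (sigmaM odd_card).
by split; ring.
Qed.
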